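(* There exists an unconditional Schauder basis $\{f_n\}_{n=0}^{\infty}$ of $\ell^{2}(\mathbb{N})$ that is an SCFC sequence, but such that no (infinite) subsequence of $\{f_n\}_{n=0}^{\infty}$ is a frame sequence.
   Context: Let $\mathcal{H}$ be a separable infinite-dimensional Hilbert space (here $\mathcal{H}=\ell^2(\mathbb{N})$). A sequence $\{h_n\}$ is a Parseval frame in $\mathcal{H}$ if $\|f\|^2=\sum_n|\langle f,h_n\rangle|^2$ for all $f\in\mathcal{H}$. A sequence $\{h_n\}$ is a frame sequence if it is a frame for its closed linear span, i.e. there are $A,B>0$ with $A\|f\|^2\le\sum_n|\langle f,h_n\rangle|^2\le B\|f\|^2$ for all $f\in\overline{\operatorname{span}\{h_n\}}$. $\{f_n\}\subseteq\mathcal{H}$ is an unconditional Schauder basis of $\mathcal{H}$ if there is $\{g_n\}\subseteq\mathcal{H}$ with $\langle f_n,g_k\rangle=\delta_{nk}$ and $f=\sum_n\langle f,g_n\rangle f_n$ with unconditional norm convergence for every $f\in\mathcal{H}$. $\{f_n\}$ is an SCFC sequence if there is a surjective bounded linear operator $B\in B(\mathcal{H})$ such that $\{Bf_n\}$ is a Parseval frame in $\mathcal{H}$. *)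

(* Defs.v *)
From HB Require Import structures.
From mathcomp Require Import all_boot all_order all_algebra.
From mathcomp Require Import complex.
From mathcomp Require Import all_classical all_reals all_analysis.
From mathcomp Require Import ring lra.

Set Implicit Arguments.
Unset Strict Implicit.
Unset Printing Implicit Defensive.

Import Order.TTheory GRing.Theory Num.Theory.
Import numFieldNormedType.Exports.
Import ComplexField.Normc.

Local Open Scope classical_set_scope.
Local Open Scope ring_scope.

Section SquareSum.
Variable R : realType.
Implicit Types (x y : nat -> R[i]^o) (a : R[i]).

Definition sqsum x : \bar R := (\sum_(0 <= k <oo) (normc (x k) ^+ 2)%:E)%E.

Definition sqsummable : {pred nat -> R[i]^o} := fun x => `[< (sqsum x < +oo)%E >].

Lemma sqsum_ge0 x : (0 <= sqsum x)%E.
Proof. by apply: nneseries_ge0 => n _ _; rewrite lee_fin sqr_ge0. Qed.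

Lemma normc_ge0 a : 0 <= normc a.
Proof. by case: a => u v /=; exact: sqrtr_ge0. Qed.

Lemma sqsum_le x n : ((normc (x n) ^+ 2)%:E <= sqsum x)%E.
Proof.
have p k : (0 <= (normc (x k) ^+ 2)%:E)%E by rewrite lee_fin sqr_ge0.
apply: le_trans (nneseries_lim_ge n.+1 _) => //.
by rewrite big_nat_recr//= leeDr// sume_ge0.
Qed.

Lemma sqsumZ a x : sqsum (a *: x) = ((normc a ^+ 2)%:E * sqsum x)%E.
Proof.
rewrite /sqsum -nneseriesZl//; last by move=> i _; rewrite lee_fin sqr_ge0.
by apply: eq_eseriesr => k _; rewrite -EFinM -exprMn -normcM.
Qed.

Lemma sqsumD_le (t : R) x y : 0 < t ->
  (sqsum (x + y)%R <= (1 + t)%:E * sqsum x + (1 + t^-1)%:E * sqsum y)%E.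
Proof.
move=> t0; have ti : 0 < t^-1 by rewrite invr_gt0.
have p z k : (0 <= (normc (z k) ^+ 2)%:E :> \bar R)%E.
  by rewrite lee_fin sqr_ge0.
rewrite /sqsum -!nneseriesZl// -nneseriesD; first last.
- by move=> i _ _; rewrite mule_ge0// lee_fin addr_ge0// ltW.
- by move=> i _ _; rewrite mule_ge0// lee_fin addr_ge0// ltW.
apply: lee_nneseries => // k _; rewrite -!EFinM -EFinD lee_fin.
have h := le_normcD (x k) (y k); have hx := normc_ge0 (x k + y k).
set u := normc (x k) in h *; set v := normc (y k) in h *.
have : normc (x k + y k) ^+ 2 <= (u + v) ^+ 2.
  by rewrite lerXn2r// nnegrE// addr_ge0// normc_ge0.
move=> /le_trans; apply.
rewrite -subr_ge0 (_ : _ - _ = t * (u - t^-1 * v) ^+ 2).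
  by apply: mulr_ge0; [exact: ltW|exact: sqr_ge0].
by field; rewrite gt_eqF.
Qed.

Lemma sqsummable_submod : submod_closed sqsummable.
Proof.
split=> [|a x y].
  apply/asboolP; rewrite /sqsum eseries0 ?ltry// => k _ _.
  by rewrite normc0 expr0n.
move=> /asboolP hx /asboolP hy; apply/asboolP.
apply: le_lt_trans (sqsumD_le (a *: x) y ltr01) _.
have ax : (sqsum (a *: x) < +oo)%E.
  by rewrite sqsumZ lte_mul_pinfty ?lee_fin ?sqr_ge0.
by rewrite lte_add_pinfty// lte_mul_pinfty// lee_fin addr_ge0// invr_ge0.
Qed.

HB.instance Definition _ :=
  GRing.isSubmodClosed.Build R[i] (nat -> R[i]^o) sqsummable sqsummable_submod.

End SquareSum.

Record l2 (R : realType) := L2 {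
  l2_fun :> nat -> R[i]^o;
  l2_funP : l2_fun \in @sqsummable R }.

HB.instance Definition _ (R : realType) := [isSub for @l2_fun R].
HB.instance Definition _ (R : realType) := [Choice of l2 R by <:].
HB.instance Definition _ (R : realType) :=
  [SubChoice_isSubLmodule of l2 R by <:].

Section L2Norm.
Variable R : realType.
Implicit Types (x y : l2 R) (a : R[i]).

Definition l2norm x : R := Num.sqrt (fine (sqsum x)).

Lemma sqsum_l2norm x : sqsum x = (l2norm x ^+ 2)%:E.
Proof.
have xoo : (sqsum x < +oo)%E by have /asboolP := l2_funP x.
rewrite sqr_sqrtr ?fine_ge0 ?sqsum_ge0// fineK//.
by rewrite ge0_fin_numE// sqsum_ge0.
Qed.

Lemma l2norm_ge0 x : 0 <= l2norm x.
Proof. exact: sqrtr_ge0. Qed.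

Lemma l2norm_eq0 x : l2norm x = 0 -> x = 0.
Proof.
move=> x0; apply/val_inj/funext => n /=; apply: eq0_normc.
have := sqsum_le x n; rewrite sqsum_l2norm x0 expr0n lee_fin /= => h.
by apply/eqP; rewrite -sqrf_eq0 eq_le h sqr_ge0.
Qed.

Lemma l2normZ a x : l2norm (a *: x) = normc a * l2norm x.
Proof.
apply/eqP; rewrite -(@eqrXn2 _ 2)// ?mulr_ge0 ?l2norm_ge0 ?normc_ge0//.
apply/eqP/EFin_inj; rewrite -sqsum_l2norm exprMn EFinM -sqsum_l2norm.
exact: sqsumZ.
Qed.

Lemma l2normD x y : l2norm (x + y) <= l2norm x + l2norm y.
Proof.
have [/l2norm_eq0 ->|x0] := eqVneq (l2norm x) 0.
  by rewrite add0r lerDr l2norm_ge0.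
have [/l2norm_eq0 ->|y0] := eqVneq (l2norm y) 0.
  by rewrite addr0 lerDl l2norm_ge0.
have {}xp : 0 < l2norm x by rewrite lt_def x0 l2norm_ge0.
have {}yp : 0 < l2norm y by rewrite lt_def y0 l2norm_ge0.
rewrite -(@ler_pXn2r _ 2)// ?nnegrE ?addr_ge0 ?l2norm_ge0//.
have := sqsumD_le x y (divr_gt0 yp xp).
rewrite (_ : _ + _ = l2_fun (x + y))// !sqsum_l2norm -!EFinM -EFinD lee_fin.
move=> /le_trans; apply; rewrite le_eqVlt; apply/orP; left; apply/eqP.
by field; rewrite x0 y0.
Qed.

(* [l2norm] seen in [R[i]]: the norm of a [normedModType R[i]] is [R[i]]-valued,
   and its topology on [l2 R] is the norm topology. *)
Definition l2_norm x : R[i] := (l2norm x)%:C%C.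

Lemma l2_normD x y : l2_norm (x + y) <= l2_norm x + l2_norm y.
Proof. by rewrite /l2_norm -rmorphD lecR l2normD. Qed.

Lemma l2_normZ a x : l2_norm (a *: x) = `|a| * l2_norm x.
Proof. by rewrite /l2_norm l2normZ rmorphM. Qed.

Lemma l2_norm_eq0 x : l2_norm x = 0 -> x = 0.
Proof. by move=> [/l2norm_eq0]. Qed.

HB.instance Definition _ := Lmodule_isNormed.Build R[i] (l2 R)
  l2_normD l2_normZ l2_norm_eq0.

End L2Norm.

Section InnerProduct.
Variable R : realType.
Implicit Types (x y z : l2 R).

(* Linear in the first argument, conjugate-linear in the second. *)
Definition dot_term x y (k : nat) : R[i]^o := (x k : R[i]) * (y k)^*.

Definition dot x y : R[i]^o := limn (series (dot_term x y)).

Let cvg_real_complex (u : nat -> R) (l : R) :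
  u @ \oo --> l -> (fun n => (u n)%:C%C : R[i]^o) @ \oo --> (l%:C%C : R[i]^o).
Proof.
move=> ul; apply/cvgrPdist_lt => e; rewrite ltcE /= => /andP[/eqP ei e0].
move/cvgrPdist_lt : ul => /(_ _ e0); apply: filterS => n h.
by rewrite -rmorphB normc_def /= expr0n /= addr0 sqrtr_sqr ltcE /= ei eqxx.
Qed.

Let dot_termE x k : dot_term x x k = (normc (x k) ^+ 2)%:C%C.
Proof. by rewrite /dot_term -normCK rmorphXn. Qed.

Lemma cvg_dot_self x :
  series (dot_term x x) @ \oo --> ((l2norm x ^+ 2)%:C%C : R[i]^o).
Proof.
rewrite (_ : series _ = fun n => (\sum_(0 <= k < n) normc (x k) ^+ 2)%:C%C).
  apply: cvg_real_complex.
  have /fine_cvg : (\sum_(0 <= k < n) (normc (x k) ^+ 2)%:E)%E @[n --> \oo]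
      --> (l2norm x ^+ 2)%:E.
    rewrite -sqsum_l2norm; apply: is_cvg_nneseries => k _ _.
    by rewrite lee_fin sqr_ge0.
  by apply: cvg_trans; apply: near_eq_cvg; near=> n; rewrite /= sumEFin.
apply/funext => n; rewrite seriesEnat rmorph_sum.
by apply: eq_bigr => k _; rewrite dot_termE.
Unshelve. all: by end_near. Qed.

Lemma dot_self x : dot x x = (l2norm x ^+ 2)%:C%C.
Proof. exact/cvg_lim/cvg_dot_self. Qed.

Let polarization (a b : R[i]) : a * b^* = 4^-1 *
  ((a + b) * (a + b)^* - (a - b) * (a - b)^* +
   'i * ((a + 'i * b) * (a + 'i * b)^* - (a - 'i * b) * (a - 'i * b)^*)).
Proof.
have i2 : 'i * 'i = -1 :> R[i] by rewrite -expr2 sqrCi.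
have iC : ('i : R[i])^* = - 'i by rewrite conjCi.
rewrite !(rmorphD, rmorphB, rmorphN, rmorphM) /= iC.
move: (_^*) (_^*) => A B.
have -> : forall j : R[i], (a + b) * (A + B) - (a - b) * (A - B) +
  j * ((a + j * b) * (A + - j * B) - (a - j * b) * (A - - j * B)) =
  2 * (a * B + b * A) + 2 * (j * j) * (b * A - a * B) by move=> j; ring.
by rewrite i2; field.
Qed.

Lemma is_cvg_dot x y : cvgn (series (dot_term x y)).
Proof.
have c z : cvgn (series (dot_term z z)) by apply: cvgP; exact: cvg_dot_self.
rewrite (_ : series _ = (4^-1 : R[i]) \*:
   (series (dot_term (x + y) (x + y)) - series (dot_term (x - y) (x - y)) +
   'i \*: (series (dot_term (x + 'i *: y) (x + 'i *: y)) -
   series (dot_term (x - 'i *: y) (x - 'i *: y))))).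
  apply: is_cvgZl_tmp; apply: is_cvgD; first exact: is_cvgB.
  by apply: is_cvgZl_tmp; exact: is_cvgB.
apply/funext => n; rewrite /= !fctE /= !seriesEnat -!sumrB scaler_sumr.
rewrite -big_split scaler_sumr; apply: eq_bigr => k _.
exact: polarization.
Qed.

End InnerProduct.

Section Sequences.
Variable R : realType.
Implicit Types (x y : l2 R) (f g h : nat -> l2 R).

(* Nonnegative series in [\bar R]: equal to [+oo] when it diverges. *)
Definition frame_sum h x : \bar R :=
  (\sum_(0 <= n <oo) (normc (dot x (h n)) ^+ 2)%:E)%E.

Definition parseval_frame h :=
  forall x, frame_sum h x = (l2norm x ^+ 2)%:E.

Definition linspan h : set (l2 R) :=
  [set x | exists (n : nat) (c : 'I_n -> R[i]), x = \sum_(i < n) c i *: h i].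

Definition frame_sequence h := exists A B : R, [/\ 0 < A, 0 < B &
  forall x, closure (linspan h) x ->
    ((A * l2norm x ^+ 2)%:E <= frame_sum h x <= (B * l2norm x ^+ 2)%:E)%E].

(* Every rearrangement of the series converges to [x] in norm. *)
Definition unconditional_sum h x := forall s : nat -> nat, bijective s ->
  series (h \o s) @ \oo --> x.

Definition unconditional_basis f := exists g,
  (forall n k, dot (f n) (g k) = (n == k)%:R) /\
  (forall x, unconditional_sum (fun n => dot x (g n) *: f n) x).

Definition bounded_operator (B : {linear l2 R -> l2 R}) :=
  exists M : R, forall x, l2norm (B x) <= M * l2norm x.

Definition SCFC f := exists B : {linear l2 R -> l2 R},
  [/\ bounded_operator B, (forall y, exists x, B x = y) &
      parseval_frame (B \o f)].

End Sequences.

(* Main.v *)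
Require Import Defs.
From mathcomp Require Import all_boot all_order all_algebra.
From mathcomp Require Import all_classical all_reals all_analysis.
From HB Require Import structures.
From mathcomp Require Import complex ring lra.

Set Implicit Arguments.
Unset Strict Implicit.
Unset Printing Implicit Defensive.

Import Order.TTheory GRing.Theory Num.Theory.
Import numFieldNormedType.Exports.
Import ComplexField.Normc.

Local Open Scope classical_set_scope.
Local Open Scope ring_scope.

(** The basis is a weighted copy [f_n = c_n e_n] of the standard unit vectors.
With [m = k + 1], the weights are [c_(2k) = 1/m] and [c_(2k+1) = m], so [c_n]
comes close to [0] along the even indices and grows without bound along the odd
ones.

Nonzero weights do not affect unconditional convergence: the biorthogonal
sequence is [e_n / c_n], and the expansion of [x] is always the series of the
[x_n e_n], whose rearrangements converge because any sum that contains the first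
[M] terms misses [x] by at most the tail of [x] after [M]
([cvg_rearranged_expansion]).

A frame sequence drawn from the [f_n] must satisfy [A <= c_n ^ 2 <= B] on its
indices: test the frame inequalities on the unit vectors [e_n] in its span
([frame_sequence_scaled_unit_bounded]).  No increasing sequence of indices has
this property, since [c_n ^ 2] is either at most [1/m] or at least [m], and
[m] tends to infinity ([weight_not_trapped]).

The two kinds of weights have to coexist.  For the [B f_n] to be a Parseval
frame, [B] must compensate the weights; with [c_n -> 0] or [c_n -> oo] alone
this would force the identity, respectively the surjection [B], to be compact.
Here [B] folds the coordinates in pairs,
[(B x)_k = x_(2k) + beta_k x_(2k+1)].  The small weights stay on the coefficient
[1], which makes [B] onto, while the large weights meet a coefficient [beta_k]
of order [1/m], which is bounded.  Since [B f_(2k)] and [B f_(2k+1)] are the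
multiples [c_(2k) e_k] and [beta_k c_(2k+1) e_k], they form a Parseval frame as
soon as [c_(2k) ^ 2 + (beta_k c_(2k+1)) ^ 2 = 1] ([fold_parseval]), and this
equation determines [beta_k]. *)

(** * Series of nonnegative terms *)

Section NonnegativeSeries.
Variable R : realType.
Implicit Types (u : nat -> \bar R).
Local Open Scope ereal_scope.

Lemma nneseries_single u n : (forall k, 0 <= u k) ->
  (forall k, k != n -> u k = 0) -> \sum_(0 <= k <oo) u k = u n.
Proof.
move=> u0 un; rewrite (@nneseriesD1 _ u n xpredT)// eseries0 ?adde0//.
by move=> i _ /= /un.
Qed.

Lemma cvg_double : double @ \oo --> \oo.
Proof.
apply/cvgnyPge => A; exists A => // n /= /leq_trans; apply.
by rewrite -addnn leq_addr.
Qed.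

(** The partial sums on the right are the even-indexed partial sums on the left,
and nonnegativity guarantees that the latter have a limit. *)
Lemma nneseries_pairs u : (forall n, 0 <= u n) ->
  \sum_(0 <= n <oo) u n = \sum_(0 <= k <oo) (u k.*2 + u k.*2.+1).
Proof.
move=> u0; apply/esym/cvg_lim => //.
rewrite (_ : (fun N => _) = (fun N => \sum_(0 <= n < N) u n) \o double).
  by apply: (cvg_comp _ _ cvg_double); exact: is_cvg_nneseries.
apply/funext => N /=; elim: N => [|N IH]; first by rewrite !big_nil.
by rewrite doubleS !big_nat_recr//= IH addeA.
Qed.

End NonnegativeSeries.

(** * Unit vectors and rearranged expansions *)

Section UnitVectors.
Variable R : realType.
Implicit Types (x y : l2 R) (a : R[i]).

Lemma normc_sqr_ge0 a : (0 <= (normc a ^+ 2)%:E :> \bar R)%E.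
Proof. by rewrite lee_fin sqr_ge0. Qed.

Lemma normc_real (r : R) : normc r%:C%C = `|r|.
Proof. by rewrite /= expr0n /= addr0 sqrtr_sqr. Qed.

Lemma sqsummable_unit n : (fun k => (k == n)%:R : R[i]^o) \in @sqsummable R.
Proof.
apply/asboolP; rewrite /sqsum (@nneseries_single _ _ n) ?ltry//.
  by move=> k; exact: normc_sqr_ge0.
by move=> k /negPf ->; rewrite normc0 expr0n.
Qed.

Definition unit_vec n : l2 R := L2 (sqsummable_unit n).

Lemma l2norm_unit_vec n : l2norm (unit_vec n) = 1.
Proof.
rewrite /l2norm /sqsum (@nneseries_single _ _ n) /=.
- by rewrite eqxx normc1 expr1n sqrtr1.
- by move=> k; exact: normc_sqr_ge0.
by move=> k /negPf ->; rewrite normc0 expr0n.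
Qed.

Lemma unit_vecE n k : unit_vec n k = (k == n)%:R.
Proof. by []. Qed.

Lemma l2_scaleE a x k : (a *: x) k = a * x k.
Proof. by []. Qed.

Lemma l2_sumE I (s : seq I) (F : I -> l2 R) k :
  (\sum_(i <- s) F i) k = \sum_(i <- s) F i k.
Proof.
by elim: s => [|i s IH]; rewrite ?big_nil// !big_cons -IH.
Qed.

Lemma dot_unitr x a n : dot x (a *: unit_vec n) = x n * a^*.
Proof.
have tE k : dot_term x (a *: unit_vec n) k = if k == n then x n * a^* else 0.
  rewrite /dot_term l2_scaleE unit_vecE.
  by case: eqP => [->|_]; rewrite ?mulr1// mulr0 conjC0 mulr0.
apply/cvg_lim => //; apply: cvg_near_cst; exists n.+1 => // N /= nN.
rewrite /series /=; under eq_bigr do rewrite tE.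
by rewrite -big_mkcond /= big_nat1_eq nN.
Qed.

(** Once the indices [s 0, ..., s (N - 1)] cover [0, ..., M - 1], the error of
the [N]-th partial sum keeps only coordinates of [x] of index at least [M], so
its squared norm is at most the tail of [sqsum x] from [M] on. *)
Lemma cvg_rearranged_expansion x (s : nat -> nat) : bijective s ->
  series (fun i => x (s i) *: unit_vec (s i)) @ \oo --> x.
Proof.
case=> t st ts; apply/cvgrPdist_lt => -[e ei]; rewrite ltcE /= => /andP[ei0 e0].
have xoo : (sqsum x < +oo)%E by have /asboolP := l2_funP x.
have := nneseries_tail_cvg xoo (fun k _ => normc_sqr_ge0 (x k)).
have e2 : (0 < (e ^+ 2)%:E)%E by rewrite lte_fin exprn_gt0.
move=> /(_ _ (open_ereal_lt' e2)).
case=> M _ /(_ M (leqnn M)) /= tailM.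
(* [t] inverts [s], so the index [i] occurs at the position [t i]. *)
exists (\max_(i < M) (t i).+1)%N => // N /= leN.
set d : l2 R := x - _.
have dE k : d k = if (t k < N)%N then 0 else x k.
  rewrite (_ : d k = x k - series (fun i => x (s i) *: unit_vec (s i)) N k)//.
  rewrite /series /= l2_sumE.
  under eq_bigr => i _.
    rewrite l2_scaleE unit_vecE -(can2_eq ts st) eq_sym mulr_natr mulrb.
    over.
  rewrite -big_mkcond /= big_nat1_eq /=.
  by case: ifP; rewrite ?ts ?subrr ?subr0.
have : (sqsum (l2_fun d) < (e ^+ 2)%:E)%E.
  apply: le_lt_trans tailM.
  rewrite /sqsum (@nneseries_split _ _ 0 M); last first.
    by move=> k _; exact: normc_sqr_ge0.
  rewrite add0n big_nat big1 ?add0e; last first.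
    move=> k kM; rewrite dE ifT ?normc0 ?expr0n//.
    apply: leq_trans leN.
    exact: (@leq_bigmax _ (fun i : 'I_M => (t i).+1) (Ordinal kM)).
  apply: lee_nneseries => [k _ _|k _]; first exact: normc_sqr_ge0.
  rewrite dE lee_fin; case: ifP => // _.
  by rewrite normc0 expr0n sqr_ge0.
rewrite sqsum_l2norm lte_fin ltr_pXn2r ?nnegrE ?l2norm_ge0 ?(ltW e0)// => h.
by rewrite ltcE /= ei0 h.
Qed.

End UnitVectors.

(** * Weighted unit vectors *)

Section ScaledUnitVectors.
Variables (R : realType) (c : nat -> R).
Implicit Types (x y : l2 R).

Definition scaled_unit n : l2 R := (c n)%:C%C *: unit_vec R n.

Lemma dot_real_unitr x (r : R) n :
  dot x (r%:C%C *: unit_vec R n) = x n * r%:C%C.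
Proof.
by rewrite dot_unitr; congr (_ * _); rewrite conj_Creal// complex_real.
Qed.

(** The weight of [c_n e_n] cancels against that of the dual vector [e_n / c_n],
which leaves the unweighted expansion. *)
Lemma scaled_unit_unconditional_basis : (forall n, c n != 0) ->
  unconditional_basis scaled_unit.
Proof.
move=> c0; exists (fun n => ((c n)^-1)%:C%C *: unit_vec R n).
split=> [n k|x s bs].
  rewrite dot_real_unitr /scaled_unit l2_scaleE unit_vecE eq_sym.
  case: eqP => [->|_]; last by rewrite mulr0 mul0r.
  by rewrite mulr1 -rmorphM /= divff.
rewrite (_ : _ \o s = fun i => x (s i) *: unit_vec R (s i)).
  exact: cvg_rearranged_expansion.
apply/funext => i /=; rewrite dot_real_unitr scalerA -mulrA -rmorphM /=.
by rewrite mulVf// mulr1.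
Qed.

(** On the unit vector [e_(phi j)], which lies in the span, the frame sum has
the single nonzero term [c (phi j) ^+ 2]. *)
Lemma frame_sequence_scaled_unit_bounded phi :
  (forall n, c n != 0) -> injective phi ->
  frame_sequence (scaled_unit \o phi) ->
  exists A B : R, [/\ 0 < A, 0 < B & forall j, A <= c (phi j) ^+ 2 <= B].
Proof.
move=> c0 phiI [A [B [A0 B0 h]]]; exists A, B; split=> // j.
have : closure (linspan (scaled_unit \o phi)) (unit_vec R (phi j)).
  apply: subset_closure.
  exists j.+1, (fun i => (i == ord_max)%:R * ((c (phi j))^-1)%:C%C).
  rewrite (bigD1 ord_max)//= big1 => [|i /negPf ->]; last first.
    by rewrite mul0r scale0r.
  by rewrite eqxx mul1r addr0 scalerA -rmorphM /= mulVf// scale1r.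
move=> /h.
rewrite l2norm_unit_vec expr1n !mulr1 /frame_sum (@nneseries_single _ _ j).
- rewrite dot_real_unitr unit_vecE eqxx mul1r normc_real.
  by rewrite real_normK ?num_real.
- by move=> k; exact: normc_sqr_ge0.
move=> k /negPf kj; rewrite dot_real_unitr unit_vecE (inj_eq phiI) kj mul0r.
by rewrite normc0 expr0n.
Qed.

End ScaledUnitVectors.

(** * Folding pairs of coordinates *)

Section Folding.
Variables (R : realType) (beta : nat -> R).
Hypothesis beta_le1 : forall k, `|beta k| <= 1.
Implicit Types (x y : l2 R).

Definition fold_fun x : nat -> R[i]^o :=
  fun k => x k.*2 + (beta k)%:C%C * x k.*2.+1.

(** The inequality [(p + q) ^ 2 <= 2 (p ^ 2 + q ^ 2)] already gives the factor
[2]; the larger [4] is a square, so that [2] bounds the operator norm. *)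
Lemma sqsum_fold_fun_le x : (sqsum (fold_fun x) <= 4%:E * sqsum x)%E.
Proof.
rewrite /sqsum -nneseriesZl//; last by move=> i _; exact: normc_sqr_ge0.
rewrite [leRHS]nneseries_pairs; last first.
  by move=> k; rewrite mule_ge0 ?normc_sqr_ge0// lee_fin.
apply: lee_nneseries => [k _ _|k _]; first exact: normc_sqr_ge0.
rewrite -!EFinM -EFinD lee_fin /fold_fun.
set z := (X in normc X ^+ 2 <= _).
have z0 := normc_ge0 z; have o0 := normc_ge0 (x k.*2.+1).
have zle : normc z <= normc (x k.*2) + normc (x k.*2.+1).
  apply: le_trans (le_normcD _ _) _.
  by rewrite lerD2l normcM normc_real ler_piMl.
apply: (@le_trans _ _ ((normc (x k.*2) + normc (x k.*2.+1)) ^+ 2)).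
  by rewrite lerXn2r// nnegrE (le_trans z0).
by nra.
Qed.

Lemma sqsummable_fold x : fold_fun x \in @sqsummable R.
Proof.
apply/asboolP; apply: le_lt_trans (sqsum_fold_fun_le x) _.
by rewrite sqsum_l2norm -EFinM ltry.
Qed.

Definition fold x : l2 R := L2 (sqsummable_fold x).

Lemma fold_is_linear : linear fold.
Proof.
move=> a x y; apply/val_inj/funext => k /=.
rewrite /fold_fun.
rewrite -[(a *: x + y) _]/(a * x k.*2 + y k.*2).
rewrite -[(a *: x + y) _]/(a * x k.*2.+1 + y k.*2.+1).
rewrite -[RHS]/(a * (x k.*2 + (beta k)%:C%C * x k.*2.+1) +
  (y k.*2 + (beta k)%:C%C * y k.*2.+1)).
by ring.
Qed.

HB.instance Definition _ := GRing.isLinear.Build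
  R[i] (l2 R) (l2 R) *:%R fold fold_is_linear.

Lemma fold_bounded : bounded_operator fold.
Proof.
exists 2 => x; rewrite -(@ler_pXn2r _ 2)// ?nnegrE ?mulr_ge0 ?l2norm_ge0//.
have := sqsum_fold_fun_le x.
rewrite -[fold_fun x]/(l2_fun (fold x)) !sqsum_l2norm -EFinM lee_fin exprMn.
by rewrite -natrX.
Qed.

(** A preimage places [y] on the even coordinates, where the coefficient of the
folding is [1]. *)
Lemma fold_surj y : exists x, fold x = y.
Proof.
pose z n : R[i]^o := if odd n then 0 else y n./2.
have zeven k : z k.*2 = y k by rewrite /z odd_double doubleK.
have zodd k : z k.*2.+1 = 0 by rewrite /z /= odd_double.
have zP : z \in @sqsummable R.
  apply/asboolP; have /asboolP := l2_funP y.
  rewrite /sqsum [in X in _ -> X]nneseries_pairs; last first.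
    by move=> k; exact: normc_sqr_ge0.
  under [in X in _ -> X]eq_eseriesr => k _.
    rewrite zeven zodd normc0 expr0n adde0.
    over.
  by [].
exists (L2 zP); apply/val_inj/funext => k /=.
by rewrite /fold_fun /= zeven zodd mulr0 addr0.
Qed.

(** Both vectors of the [k]-th pair are sent to multiples of [e_k], so the frame
sum groups into the terms [|y_k| ^ 2] times the sum of the two squared
factors. *)
Lemma fold_parseval (c : nat -> R) :
  (forall k, c k.*2 ^+ 2 + (beta k * c k.*2.+1) ^+ 2 = 1) ->
  parseval_frame (fold \o scaled_unit c).
Proof.
move=> h y; rewrite -sqsum_l2norm /frame_sum nneseries_pairs; last first.
  by move=> n; exact: normc_sqr_ge0.
apply: eq_eseriesr => k _ /=.
have -> : fold (scaled_unit c k.*2) = (c k.*2)%:C%C *: unit_vec R k.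
  rewrite linearZ; congr (_ *: _); apply/val_inj/funext => j /=.
  rewrite /fold_fun !unit_vecE (inj_eq double_inj) (_ : _.+1 == _ = false).
    by rewrite mulr0 addr0.
  by apply/eqP => /(congr1 odd) /=; rewrite !odd_double.
have -> : fold (scaled_unit c k.*2.+1) =
    (beta k * c k.*2.+1)%:C%C *: unit_vec R k.
  rewrite mulrC rmorphM -scalerA linearZ; congr (_ *: _).
  apply/val_inj/funext => j /=.
  rewrite /fold_fun !unit_vecE eqSS (inj_eq double_inj) (_ : _ == _.+1 = false).
    rewrite add0r -[RHS]/((beta k)%:C%C * (j == k)%:R).
    by case: eqP => [->|]; rewrite ?mulr0.
  by apply/eqP => /(congr1 odd) /=; rewrite !odd_double.
rewrite !dot_real_unitr !normcM !normc_real !exprMn !real_normK ?num_real//.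
by rewrite -EFinD -mulrDr -[in RHS](mulr1 (_ ^+ 2)) -(h k) exprMn.
Qed.

End Folding.

(** * The weights *)

Section Weights.
Variable R : realType.

Definition weight n : R :=
  if odd n then n./2.+1%:R else n./2.+1%:R^-1.

(** The nonnegative solution [beta_k] of
[weight k.*2 ^+ 2 + (beta_k * weight k.*2.+1) ^+ 2 = 1]. *)
Definition coupling k : R := Num.sqrt (1 - k.+1%:R^-2) / k.+1%:R.

Lemma weight_neq0 n : weight n != 0.
Proof. by rewrite /weight; case: ifP; rewrite ?invr_eq0 pnatr_eq0. Qed.

Let inv_sqr_le1 k : k.+1%:R^-2 <= 1 :> R.
Proof. by rewrite invf_le1 ?exprn_gt0 ?ltr0n// expr_ge1// ler1n. Qed.

Lemma coupling_le1 k : `|coupling k| <= 1.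
Proof.
rewrite normrM normfV normr_nat ger0_norm ?sqrtr_ge0//.
rewrite ler_pdivrMr ?ltr0n// mul1r.
apply: (@le_trans _ _ 1); last by rewrite ler1n.
by rewrite -[leRHS]sqrtr1 ler_wsqrtr// gerBl invr_ge0 exprn_ge0.
Qed.

Lemma weight_coupling k :
  weight k.*2 ^+ 2 + (coupling k * weight k.*2.+1) ^+ 2 = 1.
Proof.
rewrite /weight /= odd_double /= uphalf_double doubleK /coupling.
rewrite divfK ?pnatr_eq0// sqr_sqrtr ?subr_ge0// exprVn.
by rewrite addrC subrK.
Qed.

(** For [j = 2 N] with [N] large, the index [n = phi j >= j] has [m = n./2 + 1]
larger than both [B] and [A^-1]; then [weight n ^+ 2] is [m ^+ 2 > B] or
[m ^- 2 < A], according to the parity of [n]. *)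
Lemma weight_not_trapped (phi : nat -> nat) (A B : R) :
  (forall j, (j <= phi j)%N) -> 0 < A ->
  ~ forall j, A <= weight (phi j) ^+ 2 <= B.
Proof.
move=> phi_ge A0 h.
pose N := Num.bound (Num.max `|B| A^-1).
have := h N.*2; have := phi_ge N.*2.
set n := phi _ => Nn.
set m : R := n./2.+1%:R.
have m0 : 0 < m by rewrite ltr0n.
have mN : Num.max `|B| A^-1 < m.
  apply: lt_le_trans (archi_boundP _) _; first by rewrite le_max normr_ge0.
  by rewrite ler_nat -/N leqW// -[N]doubleK half_leq.
have mm : m <= m ^+ 2 by rewrite expr2 ler_peMr ?(ltW m0)// ler1n.
move: mN; rewrite gt_max => /andP[mB mA].
rewrite /weight -/m => /andP[lA lB].
move: lA lB; case: ifP => _ lA lB.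
  have /(le_lt_trans (le_trans mm lB)) := le_lt_trans (ler_norm B) mB.
  by rewrite ltxx.
rewrite exprVn in lA.
have : A^-1 < m ^+ 2 by exact: lt_le_trans mA mm.
by rewrite ltNge -[m ^+ 2]invrK lef_pV2 ?posrE ?invr_gt0 ?exprn_gt0// lA.
Qed.

End Weights.

Theorem theorem3p6 (R : realType) :
  exists f : nat -> l2 R,
    [/\ unconditional_basis f, SCFC f &
        forall phi : nat -> nat, {homo phi : i j / (i < j)%N} ->
          ~ frame_sequence (f \o phi)].
Proof.
exists (scaled_unit (@weight R)); split.
- by apply: scaled_unit_unconditional_basis; exact: weight_neq0.
- exists (fold (@coupling_le1 R)); split.
  + exact: fold_bounded.
  + exact: fold_surj.
  + by apply: fold_parseval; exact: weight_coupling.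
move=> phi phi_mono.
have phi_inj := incn_inj (leq_mono phi_mono).
move=> /(frame_sequence_scaled_unit_bounded (@weight_neq0 R) phi_inj).
case=> A [B [A0 _]]; apply: weight_not_trapped => //.
exact: unstable.mono_leq_infl (leq_mono phi_mono).
Qed.
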